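(* A partially ordered strict semifield is isomorphic to the real semifield $\mathbb{R}_+$ (the set of non-negative real numbers with its usual addition, multiplication and order) if and only if it is monotone sequentially complete, infima compatible, and satisfies $1+1\neq1$.
   Context: A semifield is a set $S$ with operations $+,\cdot$ and distinct elements $0,1$ such that $(S,+,0)$ and $(S,\cdot,1)$ are commutative monoids, multiplication distributes over addition, $0$ is absorbing for multiplication, and every non-zero element has a multiplicative inverse. It is strict if it is not a field (equivalently, $1$ has no additive inverse). A partially ordered strict semifield is a strict semifield with a partial order $\ge$ such that: $a\ge b$ implies $a+c\ge b+c$; $a\ge b$ implies $ac\ge bc$; and $1\ge0$. Isomorphisms are isomorphisms of semifields that are also order isomorphisms. A partially ordered strict semifield is monotone sequentially complete if every increasing sequence with an upper bound has a supremum; equivalently, if every decreasing sequence has an infimum. It is infima compatible if every decreasing sequence $(b_n)$ whose infimum exists satisfies $\inf(1+b_n)=1+\inf b_n$ (the left-hand infimum existing), including when $\inf b_n=0$. ''Increasing'' and ''decreasing'' include equality. *)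

(* Defs.v *)
From HB Require Import structures.
From mathcomp Require Import all_boot all_order all_algebra.
From mathcomp Require Import boolp classical_sets reals sequences.

Set Implicit Arguments.
Unset Strict Implicit.
Unset Printing Implicit Defensive.

Import Order.TTheory GRing.Theory Num.Theory.

Local Open Scope classical_set_scope.
Local Open Scope ring_scope.

(* The remaining semifield axioms, including 1 != 0, are those of
   comNzSemiRingType. *)
HB.mixin Record ComNzSemiRing_isSemifield S of GRing.ComNzSemiRing S := {
  semifield_inv_ex : forall a : S, a <> 0 -> exists b : S, a * b = 1
}.

#[short(type="semifieldType")]
HB.structure Definition Semifield :=
  { S of GRing.ComNzSemiRing S & ComNzSemiRing_isSemifield S }.

(* A semifield fails to be a field only by lacking additive inverses. *)
HB.mixin Record Semifield_isStrict S of Semifield S := {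
  semifield_not_field : ~ (forall a : S, exists b : S, a + b = 0)
}.

#[short(type="strictSemifieldType")]
HB.structure Definition StrictSemifield :=
  { S of Semifield S & Semifield_isStrict S }.

(* A structure inheriting from both GRing.ComNzSemiRing and Order.POrder would
   need a join already missing below Num.POrderedZmodule; so the order is
   introduced here from scratch and then registered as an instance. *)
HB.mixin Record StrictSemifield_isPOrdered S of StrictSemifield S := {
  posemifield_le : rel S;
  posemifield_le_refl : reflexive posemifield_le;
  posemifield_le_anti : antisymmetric posemifield_le;
  posemifield_le_trans : transitive posemifield_le;
  posemifield_leD2r : forall a b c : S,
    posemifield_le b a -> posemifield_le (b + c) (a + c);
  posemifield_leM2r : forall a b c : S,
    posemifield_le b a -> posemifield_le (b * c) (a * c);
  posemifield_le01 : posemifield_le 0 1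
}.

#[short(type="poStrictSemifieldType")]
HB.structure Definition POStrictSemifield :=
  { S of StrictSemifield S & StrictSemifield_isPOrdered S }.

HB.instance Definition _ (S : poStrictSemifieldType) :=
  Order.Le_isPOrder.Build ring_display (POStrictSemifield.sort S)
    (@posemifield_le_refl S) (@posemifield_le_anti S) (@posemifield_le_trans S).

(* Order isomorphisms preserve and reflect the order, whence {mono}. *)
Definition posemifield_isomorphic (S T : poStrictSemifieldType) : Prop :=
  exists f : {rmorphism S -> T}, bijective f /\ {mono f : x y / x <= y}.

Definition monotone_sequentially_complete (S : poStrictSemifieldType) : Prop :=
  forall a : nat -> S, nondecreasing_seq a ->
    has_ubound (range a) -> supremums (range a) !=set0.

(* [infimums A m] says that m is the infimum of A; so the conclusion includes
   the existence of the infimum of (1 + b n). *)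
Definition infima_compatible (S : poStrictSemifieldType) : Prop :=
  forall (b : nat -> S) (m : S), nonincreasing_seq b ->
    infimums (range b) m -> infimums (range (fun n => 1 + b n)) (1 + m).

(* The real semifield; operations and order are inherited from R. *)
Definition real_semifield (R : realType) := {x : R | x \is Num.nneg}.

Section RealSemifield.
Variable R : realType.
Local Notation Rp := (real_semifield R).

HB.instance Definition _ := [isSub of Rp for @sval _ _].
HB.instance Definition _ := [Choice of Rp by <:].
HB.instance Definition _ := [SubChoice_isSubComNzSemiRing of Rp by <:].
HB.instance Definition _ : Order.POrder ring_display Rp := [POrder of Rp by <:].

Lemma real_semifield_leE (a b : Rp) : (a <= b) = (val a <= val b).
Proof. by []. Qed.

Lemma real_semifield_inv_ex (a : Rp) : a <> 0 -> exists b : Rp, a * b = 1.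
Proof.
move=> a0; have Va : (val a)^-1 \is Num.nneg by rewrite rpredV; exact: valP.
exists (Sub (val a)^-1 Va); apply: val_inj.
rewrite rmorphM rmorph1 /= divff //.
by apply/eqP => va0; apply: a0; apply: val_inj; rewrite rmorph0.
Qed.

HB.instance Definition _ :=
  ComNzSemiRing_isSemifield.Build Rp real_semifield_inv_ex.

Lemma real_semifield_not_field : ~ (forall a : Rp, exists b : Rp, a + b = 0).
Proof.
move=> /(_ 1)[b] /(congr1 val); rewrite rmorphD rmorph1 rmorph0 /= => /eqP.
have : 0 <= val b := valP b.
by move=> b0; rewrite gt_eqF// ltr_pwDl.
Qed.

HB.instance Definition _ := Semifield_isStrict.Build Rp real_semifield_not_field.

Lemma real_semifield_leD2r (a b c : Rp) : b <= a -> b + c <= a + c.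
Proof. by rewrite !real_semifield_leE !rmorphD lerD2r. Qed.

Lemma real_semifield_leM2r (a b c : Rp) : b <= a -> b * c <= a * c.
Proof.
rewrite !real_semifield_leE !rmorphM; apply: ler_wpM2r.
exact: (valP c).
Qed.

Lemma real_semifield_le01 : (0 : Rp) <= 1.
Proof. by rewrite real_semifield_leE rmorph0 rmorph1. Qed.

HB.instance Definition _ := StrictSemifield_isPOrdered.Build Rp
  lexx le_anti le_trans
  real_semifield_leD2r real_semifield_leM2r real_semifield_le01.

End RealSemifield.

(* Main.v *)
From HB Require Import structures.
Require Import Defs.
From mathcomp Require Import all_boot all_order all_algebra.
From mathcomp Require Import boolp classical_sets reals sequences.
From mathcomp Require Import ring lra.
Set Implicit Arguments.
Unset Strict Implicit.
Unset Printing Implicit Defensive.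

Import Order.TTheory GRing.Theory Num.Theory.
Local Open Scope classical_set_scope.
Local Open Scope ring_scope.

(** Everything rests on showing that the order of [S] is total; from there one
builds an isomorphism onto the non-negative reals by dyadic approximation, as
for an Archimedean ordered field.

Completeness alone controls growth ([bounded_growth]): if [B] increases, is
bounded with supremum [s], and gains a factor at least [u] at each step, then
[u * s <= s], hence [u <= 1].  With [u = 2] and [2 != 1] this says that the
powers of [2] are unbounded.  Infima compatibility turns unboundedness into an
Archimedean principle ([le_of_unbounded]): if [B] increases without bound then
[c / B n] decreases to [0], so [a <= b + c / B n] for all [n] forces [a <= b].

Totality comes from an inequality between geometric sums.  Over the reals, if
[u * v < 1] then one of the series of powers of [u] and of [v] converges.  The
trace of this fact that needs no comparison is that the partial sums [U m] and
[V n] satisfy [U m * V n <= K * (V n + U m)] as soon as [1 + u * v * K <= K]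
([geometric_sum_mul]): in the product the powers of [u * v] add up to at most
[K].  If the [V n] are unbounded, dividing by [V n] and using the Archimedean
principle gives [U m <= K]; so one of the two families is bounded, and then
[u <= 1] or [v <= 1] by the growth lemma ([le1_or_le1]).  For nonzero [a], [b]
and [e], take [u = a / (b (1 + e))] and [v = b / (a (1 + e))]: either
[a <= b (1 + e)] or [b <= a (1 + e)] ([almost_total]).  Letting [e] run through
the inverse powers of [2] gives totality ([semifield_le_total]).

Every [a] then lies between consecutive integers, and so does each
[a * 2 ^+ n].  The supremum of the dyadic numbers below [a] is a real number
[dyadic_value a] in the same dyadic brackets as [a]; this makes it additive and
order-reflecting.  It is multiplicative because, up to scaling, it is the only
additive monotone map ([additive_dyadic_value]), and it is onto because [S] has
suprema of increasing sequences.

Conversely, the two completeness conditions hold for the non-negative reals and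
are invariant under order isomorphism. *)

(** * Arithmetic of partially ordered semifields *)

Section OrderedSemifield.
Variable S : poStrictSemifieldType.
Implicit Types (a b c d u v : S) (B C : nat -> S).

Lemma semifield_leD2r a b c : a <= b -> a + c <= b + c.
Proof. exact: posemifield_leD2r. Qed.

Lemma semifield_leM2r a b c : a <= b -> a * c <= b * c.
Proof. exact: posemifield_leM2r. Qed.

Lemma semifield_leM2l a b c : a <= b -> c * a <= c * b.
Proof. by rewrite ![c * _]mulrC; exact: semifield_leM2r. Qed.

Lemma semifield_leD a b c d : a <= b -> c <= d -> a + c <= b + d.
Proof.
move=> ab cd; apply: le_trans (semifield_leD2r c ab) _.
by rewrite ![b + _]addrC; exact: semifield_leD2r.
Qed.

Lemma semifield_ge0 a : (0 : S) <= a.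
Proof.
rewrite -[a]mul1r -[0 in leLHS](mul0r a).
by apply: semifield_leM2r; exact: posemifield_le01.
Qed.

Lemma semifield_leDl a b : a <= a + b.
Proof.
by rewrite -[leLHS]addr0; apply: semifield_leD => //; exact: semifield_ge0.
Qed.

Lemma semifield_leDr a b : a <= b + a.
Proof. by rewrite addrC; exact: semifield_leDl. Qed.

Lemma semifield_le_neq0 a b : a <= b -> a != 0 -> b != 0.
Proof.
move=> ab; apply: contra_neq => b0; apply: le_anti.
by rewrite semifield_ge0 andbT -b0.
Qed.

Definition semifield_inv a : S := xget 0 [set b | a * b = 1].

Lemma semifield_mulrV a : a != 0 -> a * semifield_inv a = 1.
Proof.
move=> a0; apply: (@xgetPex _ 0 [set b | a * b = 1]).
by apply: semifield_inv_ex; exact/eqP.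
Qed.

Lemma semifield_mulrK a b : b != 0 -> a * b * semifield_inv b = a.
Proof. by move=> b0; rewrite -mulrA semifield_mulrV // mulr1. Qed.

Lemma semifield_le_pM2r a b c : c != 0 -> (a * c <= b * c) = (a <= b).
Proof.
move=> c0; apply/idP/idP => [|/semifield_leM2r//].
by move=> /(semifield_leM2r (semifield_inv c)); rewrite !semifield_mulrK.
Qed.

Lemma semifield_mulf_neq0 a b : a != 0 -> b != 0 -> a * b != 0.
Proof.
move=> a0 b0; apply: contra_neq a0 => ab0.
by rewrite -[a](semifield_mulrK _ b0) ab0 mul0r.
Qed.

Lemma semifield_inv_neq0 a : a != 0 -> semifield_inv a != 0.
Proof.
move=> a0; apply/eqP => V0; have /eqP := semifield_mulrV a0.
by rewrite V0 mulr0 eq_sym (negPf (oner_neq0 _)).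
Qed.

Lemma semifield_leV2 a b : a != 0 -> a <= b -> semifield_inv b <= semifield_inv a.
Proof.
move=> a0 ab; have b0 := semifield_le_neq0 ab a0.
rewrite -(semifield_le_pM2r _ _ (semifield_mulf_neq0 a0 b0)).
rewrite [leLHS](_ : _ = a * (b * semifield_inv b)); last by ring.
rewrite [leRHS](_ : _ = b * (a * semifield_inv a)); last by ring.
by rewrite !semifield_mulrV // !mulr1.
Qed.

Lemma semifield_ler_nat m n : (m <= n)%N -> m%:R <= n%:R :> S.
Proof. by move=> /subnKC <-; rewrite natrD; exact: semifield_leDl. Qed.

Lemma pow2_neq0 n : 2 ^+ n != 0 :> S.
Proof.
apply: semifield_le_neq0 (oner_neq0 _); rewrite -natrX.
by apply: (semifield_ler_nat (m := 1)); rewrite expn_gt0.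
Qed.

(** * Growth and the Archimedean principle *)

(** A nonzero lower bound [l] of [c / B n] would give the upper bound [c / l] of
[B]. *)
Lemma unbounded_infimum B c : nondecreasing_seq B -> B 0 != 0 ->
  ~ has_ubound (range B) ->
  infimums (range (fun n => c * semifield_inv (B n))) 0.
Proof.
move=> Bnd B0 Bub.
have Bn0 n : B n != 0 by apply: semifield_le_neq0 B0; exact: Bnd.
split=> [_ [n _ <-]|l lb]; first exact: semifield_ge0.
have lB n : B n * l <= c.
  rewrite mulrC -(semifield_le_pM2r _ _ (semifield_inv_neq0 (Bn0 n))).
  by rewrite semifield_mulrK //; apply: lb; exists n.
have [->//|l0] := eqVneq l 0; case: Bub; exists (c * semifield_inv l) => _ [n _ <-].
rewrite -(semifield_mulrK (B n) l0).
exact: semifield_leM2r.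
Qed.

Section Complete.
Hypothesis complete : monotone_sequentially_complete S.

(** The supremum [s] of [B] satisfies [s * u <= s], because multiplication by a
nonzero [u] is an order automorphism and so commutes with suprema. *)
Lemma bounded_growth B u : nondecreasing_seq B -> B 0 != 0 ->
  (forall n, B n * u <= B n.+1) -> has_ubound (range B) -> u <= 1.
Proof.
move=> Bnd B0 Bu /(complete Bnd)[s [sub slub]].
have B0s : B 0 <= s by apply: sub; exists 0.
have s0 := semifield_le_neq0 B0s B0.
have [->|u0] := eqVneq u 0; first exact: semifield_ge0.
have : s <= s * semifield_inv u.
  apply: slub => _ [n _ <-]; rewrite -(semifield_mulrK (B n) u0).
  by apply: semifield_leM2r; apply: le_trans (Bu n) _; apply: sub; exists n.+1.
move=> /(semifield_leM2r u); rewrite mulrAC semifield_mulrK //.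
by rewrite mulrC -[leRHS]mul1r semifield_le_pM2r.
Qed.

Hypothesis compat : infima_compatible S.

(** This is the only use of infima compatibility: after division by [b], the
elements [1 + (c / b) / B n] decrease to [1] while staying above [a / b]. *)
Lemma le_of_unbounded B a b c : nondecreasing_seq B -> B 0 != 0 ->
  ~ has_ubound (range B) -> (forall n, a * B n <= b * B n + c) -> a <= b.
Proof.
move=> Bnd B0 Bub aB.
have Bn0 n : B n != 0 by apply: semifield_le_neq0 B0; exact: Bnd.
have [b0|b0] := eqVneq b 0.
  have [->|a0] := eqVneq a 0; first exact: semifield_ge0.
  case: Bub; exists (c * semifield_inv a) => _ [n _ <-].
  rewrite -(semifield_mulrK (B n) a0); apply: semifield_leM2r.
  by rewrite mulrC; apply: le_trans (aB n) _; rewrite b0 mul0r add0r.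
have nonincr : nonincreasing_seq
    (fun n => c * semifield_inv b * semifield_inv (B n)).
  by move=> m n mn; apply: semifield_leM2l; apply: semifield_leV2 => //; exact: Bnd.
have [_ glb] := compat nonincr (unbounded_infimum (c * semifield_inv b) Bnd B0 Bub).
suff : a * semifield_inv b <= 1.
  by move=> /(semifield_leM2r b); rewrite mulrAC semifield_mulrK // mul1r.
rewrite -[leRHS]addr0; apply: glb => _ [n _ <-].
rewrite -(semifield_le_pM2r _ _ (Bn0 n)) -(semifield_le_pM2r _ _ b0).
rewrite [leLHS](_ : _ = a * B n * (b * semifield_inv b)); last by ring.
rewrite [leRHS](_ : _ = b * B n + c * (b * semifield_inv b) *
  (B n * semifield_inv (B n))); last by ring.
by rewrite !semifield_mulrV // !mulr1.
Qed.

(** * Totality of the order *)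

(** The sum of the powers of [u] up to exponent [n], in Horner form: the
recursion is what the inductions below consume. *)
Fixpoint geometric_sum u n : S :=
  if n is n'.+1 then 1 + u * geometric_sum u n' else 1.

Lemma geometric_sum_nondecreasing u : nondecreasing_seq (geometric_sum u).
Proof.
apply/nondecreasing_seqP; elim=> [|n IHn] /=; first exact: semifield_leDl.
by apply: semifield_leD => //; exact: semifield_leM2l.
Qed.

(** A constant [K] with [1 + u * v * K <= K] plays the part of
[1 / (1 - u * v)].  Expanding [(1 + u U) (1 + v V)], with [U] and [V] the two
sums, leaves the product [u v (U V)] of shorter sums, which the induction
absorbs into [K]. *)
Lemma geometric_sum_mul u v K m n : 1 + u * v * K <= K ->
  geometric_sum u m * geometric_sum v n <=
  K * geometric_sum v n + K * geometric_sum u m.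
Proof.
move=> KP; have K1 : (1 : S) <= K := le_trans (semifield_leDl _ _) KP.
have geK x : x <= K * x by rewrite -[leLHS]mul1r; exact: semifield_leM2r.
elim: m n => [|m IHm] n.
  by rewrite mul1r; apply: le_trans (geK _) (semifield_leDl _ _).
case: n => [|n].
  by rewrite mulr1; apply: le_trans (geK _) (semifield_leDr _ _).
have Bm := geometric_sum_nondecreasing u (leqnSn m).
have Cn := geometric_sum_nondecreasing v (leqnSn n).
rewrite -mulrDr; apply: le_trans (semifield_leM2r _ KP).
rewrite [leRHS](_ : _ = (geometric_sum v n.+1 + geometric_sum u m.+1) +
  u * v * (K * geometric_sum v n.+1 + K * geometric_sum u m.+1)); last by ring.
rewrite [leLHS](_ : _ = (u * geometric_sum u m + geometric_sum v n.+1) +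
  u * v * (geometric_sum u m * geometric_sum v n)); last by rewrite /=; ring.
apply: semifield_leD.
  rewrite [leRHS]addrC; apply: semifield_leD2r; exact: semifield_leDr.
apply: semifield_leM2l; apply: le_trans (IHm n) _.
by apply: semifield_leD; apply: semifield_leM2l.
Qed.

(** Divided by an unbounded [geometric_sum v n], the bound on the product leaves
[geometric_sum u m <= K]; so at least one of the families is bounded, and
bounded geometric sums have ratio at most [1]. *)
Lemma le1_or_le1 u v K : 1 + u * v * K <= K -> u <= 1 \/ v <= 1.
Proof.
move=> KP; have B0 w : geometric_sum w 0 != 0 := oner_neq0 _.
have le1 w : has_ubound (range (geometric_sum w)) -> w <= 1.
  apply: bounded_growth => // [|n]; first exact: geometric_sum_nondecreasing.
  by rewrite /= mulrC; exact: semifield_leDr.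
have [/le1|vub] := pselect (has_ubound (range (geometric_sum v))); first by right.
left; apply: le1; exists K => _ [m _ <-].
apply: (le_of_unbounded (@geometric_sum_nondecreasing v) (B0 v) vub) => n.
exact: geometric_sum_mul KP.
Qed.

(** The ratios [a / (b (1 + e))] and [b / (a (1 + e))] have product
[(1 + e)^-2]; the constant [(1 + e)^2 / e] is admissible for it because
[(1 + e)^2 >= 1 + e]. *)
Lemma almost_total a b e : e != 0 ->
  a <= b * (1 + e) \/ b <= a * (1 + e).
Proof.
move=> e0.
have [->|a0] := eqVneq a 0; first by left; exact: semifield_ge0.
have [->|b0] := eqVneq b 0; first by right; exact: semifield_ge0.
set w := 1 + e.
have w0 : w != 0 := semifield_le_neq0 (semifield_leDl 1 e) (oner_neq0 _).
have bw0 := semifield_mulf_neq0 b0 w0; have aw0 := semifield_mulf_neq0 a0 w0.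
have ww0 := semifield_mulf_neq0 w0 w0.
pose u := a * semifield_inv (b * w); pose v := b * semifield_inv (a * w).
have uE : u * (b * w) = a by rewrite /u mulrAC semifield_mulrK.
have vE : v * (a * w) = b by rewrite /v mulrAC semifield_mulrK.
have uvE : u * v * (w * w) = 1.
  rewrite -[LHS](semifield_mulrK _ (semifield_mulf_neq0 a0 b0)).
  rewrite [X in X * semifield_inv _](_ : _ = u * (b * w) * (v * (a * w))).
    by rewrite uE vE semifield_mulrV // semifield_mulf_neq0.
  by ring.
have [|u1|v1] := @le1_or_le1 u v (w * w * semifield_inv e).
- rewrite mulrA uvE mul1r -(semifield_le_pM2r _ _ e0).
  rewrite [leLHS](_ : _ = e + e * semifield_inv e); last by ring.
  rewrite [leRHS](_ : _ = w * w * (e * semifield_inv e)); last by ring.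
  rewrite semifield_mulrV // mulr1.
  rewrite [leRHS](_ : _ = (e + 1) + (e + e * e)); last by rewrite /w; ring.
  exact: semifield_leDl.
- by left; rewrite -[a]uE -[leRHS]mul1r; exact: semifield_leM2r.
- by right; rewrite -[b]vE -[leRHS]mul1r; exact: semifield_leM2r.
Qed.

Hypothesis two_neq1 : (1 + 1 : S) <> 1.

Lemma pow2_nondecreasing : nondecreasing_seq (fun n => 2 ^+ n : S).
Proof.
apply/nondecreasing_seqP => n.
by rewrite exprS mulr2n mulrDl mul1r; exact: semifield_leDl.
Qed.

Lemma pow2_unbounded : ~ has_ubound (range (fun n => 2 ^+ n : S)).
Proof.
move=> ub; apply: two_neq1; apply: le_anti; rewrite semifield_leDl andbT.
apply: bounded_growth ub => [||n]; first exact: pow2_nondecreasing.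
  exact: oner_neq0.
by rewrite exprSr mulr2n.
Qed.

Lemma le_of_pow2 a b c : (forall n, a * 2 ^+ n <= b * 2 ^+ n + c) -> a <= b.
Proof.
apply: le_of_unbounded; first exact: pow2_nondecreasing.
- exact: pow2_neq0.
- exact: pow2_unbounded.
Qed.

(** If [a <= b] fails, then so does [a <= b (1 + 2^-i)] for some [i]; the other
alternative of [almost_total] is then forced at every finer scale. *)
Lemma semifield_le_total a b : a <= b \/ b <= a.
Proof.
have [ab|/existsNP[i abi]] :=
  pselect (forall n, a * 2 ^+ n <= b * 2 ^+ n + b).
  by left; exact: le_of_pow2 ab.
right; apply: (@le_of_pow2 _ _ a) => j.
pose k := maxn i j; pose e := semifield_inv (2 ^+ k : S).
have e0 : e != 0 by apply: semifield_inv_neq0; exact: pow2_neq0.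
have eP l : (l <= k)%N -> e * 2 ^+ l <= 1.
  move=> lk; rewrite -[leRHS](semifield_mulrV (pow2_neq0 k)) mulrC.
  by apply: semifield_leM2r; exact: pow2_nondecreasing.
have scale x y l : (l <= k)%N -> x <= y * (1 + e) -> x * 2 ^+ l <= y * 2 ^+ l + y.
  move=> lk /(semifield_leM2r (2 ^+ l)) /le_trans; apply.
  rewrite mulrDr mulr1 mulrDl -mulrA; apply: semifield_leD => //.
  by rewrite -[leRHS]mulr1; apply: semifield_leM2l; exact: eP.
have [/scale ab|/scale] := almost_total a b e0; last by apply; rewrite leq_maxr.
by case: abi; apply: ab; rewrite leq_maxl.
Qed.

Lemma exists_floor a : exists p, (p%:R : S) <= a <= p.+1%:R.
Proof.
have exP : exists n, a <= n.+1%:R.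
  apply: contra_notP pow2_unbounded => /forallNP nle; exists a => _ [n _ <-].
  have [//|alt] := semifield_le_total (2 ^+ n) a.
  case: (nle (2 ^ n)%N); apply: le_trans alt _; rewrite -natrX.
  exact: semifield_ler_nat.
case: (ex_minnP exP) => -[|p] pP pmin; first by exists 0%N; rewrite semifield_ge0.
exists p.+1; rewrite pP andbT.
have [//|/pmin] := semifield_le_total p.+1%:R a.
by rewrite ltnn.
Qed.

(** If [n + 1 <= n] held in [S], iterating it would bound all powers of [2]. *)
Lemma semifield_le_natE m n : (m%:R <= n%:R :> S) = (m <= n)%N.
Proof.
apply/idP/idP; last exact: semifield_ler_nat.
apply: contraTT; rewrite -ltnNge => nm; apply/negP => mn.
have S1n : n.+1%:R <= n%:R :> S by apply: le_trans mn; exact: semifield_ler_nat.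
have shift k : (n + k)%:R <= n%:R :> S.
  elim: k => [|k IHk]; first by rewrite addn0.
  rewrite addnS -addSn natrD; apply: le_trans _ IHk.
  by rewrite natrD; exact: semifield_leD2r.
apply: pow2_unbounded; exists n%:R => _ [k _ <-].
rewrite -natrX; apply: le_trans (shift (2 ^ k)%N).
by apply: semifield_ler_nat; rewrite leq_addl.
Qed.

End Complete.
End OrderedSemifield.

(** * Dyadic approximation of real numbers *)

Section Dyadic.
Variable R : realType.

Lemma real_le_of_pow2 (x y c : R) :
  (forall n, x * 2 ^+ n <= y * 2 ^+ n + c) -> x <= y.
Proof.
move=> xy; rewrite leNgt; apply/negP => yx.
have d0 : 0 < x - y by rewrite subr_gt0.
pose n := Num.bound (`|c| / (x - y)).
have : c < (x - y) * 2 ^+ n.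
  apply: le_lt_trans (ler_norm c) _; rewrite mulrC -ltr_pdivrMr //.
  apply: lt_le_trans (archi_boundP _) _; first by rewrite divr_ge0 // ltW.
  by rewrite -natrX ler_nat ltnW // ltn_expl.
by rewrite mulrBl ltrBrDl ltNge xy.
Qed.

Lemma truncn_pow2_lt (r : R) m n : 0 <= r ->
  (Num.truncn (r * 2 ^+ m) * 2 ^ n <= (Num.truncn (r * 2 ^+ n)).+1 * 2 ^ m)%N.
Proof.
move=> r0; have pw k : 0 <= (2 : R) ^+ k by exact: exprn_ge0.
have /andP[lm _] := truncn_itv (mulr_ge0 r0 (pw m)).
have /andP[_ /ltW un] := truncn_itv (mulr_ge0 r0 (pw n)).
rewrite -(ler_nat R) !natrM !natrX.
apply: le_trans (ler_wpM2r (pw n) lm) _.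
by rewrite mulrAC; exact: ler_wpM2r.
Qed.

Lemma truncn_pow2_double (r : R) n : 0 <= r ->
  (Num.truncn (r * 2 ^+ n) * 2 <= Num.truncn (r * 2 ^+ n.+1))%N.
Proof.
move=> r0; have pw k : 0 <= (2 : R) ^+ k by exact: exprn_ge0.
rewrite truncn_ge_nat ?mulr_ge0 // natrM exprSr mulrA; apply: ler_wpM2r => //.
by have /andP[] := truncn_itv (mulr_ge0 r0 (pw n)).
Qed.

End Dyadic.

(** * The isomorphism onto the non-negative reals *)

Section Value.
Variables (R : realType) (S : poStrictSemifieldType).
Hypothesis complete : monotone_sequentially_complete S.
Hypothesis compat : infima_compatible S.
Hypothesis two_neq1 : (1 + 1 : S) <> 1.
Implicit Types a b c : S.

Definition lower_dyadics a : set R :=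
  [set x | exists p n, (p%:R : S) <= a * 2 ^+ n /\ x = p%:R / 2 ^+ n].

Definition dyadic_value a : R := sup (lower_dyadics a).

Let pow2_gt0 n : 0 < (2 : R) ^+ n. Proof. exact: exprn_gt0. Qed.

Lemma lower_dyadics_neq0 a : lower_dyadics a !=set0.
Proof.
by exists (0%:R / 2 ^+ 0), 0%N, 0%N; split=> //; exact: semifield_ge0.
Qed.

(** Clearing denominators reduces the comparison to natural numbers, whose order
is the same in [S] and in [R]. *)
Lemma ubound_lower_dyadics a q m :
  a * 2 ^+ m <= q%:R -> ubound (lower_dyadics a) (q%:R / 2 ^+ m).
Proof.
move=> aq _ [p [n [pa ->]]].
rewrite ler_pdivrMr // mulrAC ler_pdivlMr //.
rewrite -!natrX -!natrM ler_nat -(semifield_le_natE complete two_neq1).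
rewrite !natrM !natrX; apply: le_trans (semifield_leM2r _ pa) _.
by rewrite mulrAC; exact: semifield_leM2r.
Qed.

Lemma dyadic_value_le a q m : a * 2 ^+ m <= q%:R ->
  dyadic_value a * 2 ^+ m <= q%:R.
Proof.
move=> aq; rewrite -ler_pdivlMr //.
by apply: ge_sup (lower_dyadics_neq0 a) _; exact: ubound_lower_dyadics.
Qed.

Lemma dyadic_value_ge a p n : (p%:R : S) <= a * 2 ^+ n ->
  p%:R <= dyadic_value a * 2 ^+ n.
Proof.
move=> pa; rewrite -ler_pdivrMr //; apply: sup_upper_bound; last by exists p, n.
split; first exact: lower_dyadics_neq0.
have [q /andP[_ aq]] := exists_floor complete compat two_neq1 a.
exists (q.+1%:R / 2 ^+ 0); apply: ubound_lower_dyadics.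
by rewrite expr0 mulr1.
Qed.

(** The common bracket through which every property of [dyadic_value] is proved:
it pins down [a] and [dyadic_value a] up to the same error [2^-n]. *)
Lemma dyadic_bracket a n : exists p,
  [/\ (p%:R : S) <= a * 2 ^+ n, a * 2 ^+ n <= p.+1%:R,
      p%:R <= dyadic_value a * 2 ^+ n & dyadic_value a * 2 ^+ n <= p.+1%:R].
Proof.
have [p /andP[pa ap]] := exists_floor complete compat two_neq1 (a * 2 ^+ n).
by exists p; split=> //; [exact: dyadic_value_ge|exact: dyadic_value_le].
Qed.

Lemma dyadic_value_ge0 a : 0 <= dyadic_value a.
Proof.
by have [p [_ _ + _]] := dyadic_bracket a 0; rewrite expr0 mulr1; exact: le_trans.
Qed.

Lemma dyadic_value_mono : {mono dyadic_value : a b / a <= b}.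
Proof.
move=> a b; apply/idP/idP => [ab|ab].
  (* The brackets of [a] and [b] overlap up to one unit on each side. *)
  apply: (le_of_pow2 complete compat two_neq1 (c := 2)) => n.
  have [p [_ ap pa _]] := dyadic_bracket a n.
  have [q [qb _ _ bq]] := dyadic_bracket b n.
  apply: le_trans ap _; apply: le_trans (semifield_leD2r 2 qb); rewrite -natrD.
  apply: semifield_ler_nat; rewrite addn2 ltnS -(ler_nat R).
  apply: le_trans pa _; apply: le_trans bq.
  by apply: ler_wpM2r => //; exact: ltW.
apply: (@real_le_of_pow2 _ _ _ 1) => n.
have [p [pa _ _ ap]] := dyadic_bracket a n.
apply: le_trans ap _; rewrite -natr1 lerD2r; apply: dyadic_value_ge.
by apply: le_trans pa _; exact: semifield_leM2r.
Qed.

Lemma dyadic_value0 : dyadic_value 0 = 0.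
Proof.
apply: le_anti; rewrite dyadic_value_ge0 andbT.
have := @dyadic_value_le 0 0 0; rewrite mul0r expr0 mulr1; exact.
Qed.

Lemma dyadic_value1 : dyadic_value 1 = 1.
Proof.
apply: le_anti.
have := @dyadic_value_le 1 1 0; have := @dyadic_value_ge 1 1 0.
by rewrite !expr0 !mulr1 => -> // ->.
Qed.

Lemma dyadic_valueD a b : dyadic_value (a + b) = dyadic_value a + dyadic_value b.
Proof.
suff bounds n : (dyadic_value (a + b) * 2 ^+ n <=
                   (dyadic_value a + dyadic_value b) * 2 ^+ n + 2) &&
                ((dyadic_value a + dyadic_value b) * 2 ^+ n <=
                   dyadic_value (a + b) * 2 ^+ n + 2).
  by apply: le_anti; apply/andP; split; apply: (@real_le_of_pow2 _ _ _ 2) => n;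
    have /andP[] := bounds n.
have [p [pa ap pa' ap']] := dyadic_bracket a n.
have [q [qb bq qb' bq']] := dyadic_bracket b n.
have := @dyadic_value_ge (a + b) (p + q) n.
rewrite mulrDl natrD => /(_ (semifield_leD pa qb)).
have := @dyadic_value_le (a + b) (p.+1 + q.+1) n.
rewrite mulrDl natrD => /(_ (semifield_leD ap bq)).
move: pa' ap' qb' bq'; rewrite -(natr1 p) -(natr1 q) mulrDl => *.
by apply/andP; split; lra.
Qed.

(** An additive monotone map is determined by its value at [1]: it commutes with
multiplication by naturals, and monotonicity confines it to the image of the
dyadic brackets. *)
Lemma additive_dyadic_value (g : S -> R) : {morph g : a b / a + b} ->
  {homo g : a b / a <= b} -> forall a, g a = dyadic_value a * g 1.
Proof.
move=> gD gle a.
have g0 : g 0 = 0 by have /eqP := gD 0 0; rewrite addr0 -subr_eq subrr => /eqP <-.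
have gn n b : g (n%:R * b) = n%:R * g b.
  elim: n => [|n IHn]; first by rewrite !mul0r.
  by rewrite -!natr1 !mulrDl !mul1r gD IHn.
have g1 : 0 <= g 1 by rewrite -g0; apply: gle; exact: semifield_ge0.
suff bounds n : (g a * 2 ^+ n <= dyadic_value a * g 1 * 2 ^+ n + g 1) &&
                (dyadic_value a * g 1 * 2 ^+ n <= g a * 2 ^+ n + g 1).
  by apply: le_anti; apply/andP; split; apply: (@real_le_of_pow2 _ _ _ (g 1)) => n;
    have /andP[] := bounds n.
have [p [pa ap pa' ap']] := dyadic_bracket a n.
have gE : g (a * 2 ^+ n) = g a * 2 ^+ n by rewrite -!natrX mulrC gn mulrC.
move: (gle _ _ pa) (gle _ _ ap); rewrite gE -[p%:R]mulr1 -[p.+1%:R]mulr1 !gn.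
have := ler_wpM2r g1 pa'; have := ler_wpM2r g1 ap'.
rewrite -(natr1 p) !mulrDl !mul1r ![_ * 2 ^+ n * g 1]mulrAC => ? ? ? ?.
by apply/andP; split; lra.
Qed.

(** Multiplication by [b] followed by [dyadic_value] is additive and monotone, so
it is a multiple of [dyadic_value]. *)
Lemma dyadic_valueM a b : dyadic_value (a * b) = dyadic_value a * dyadic_value b.
Proof.
rewrite -[b in RHS]mul1r.
apply: (additive_dyadic_value (g := fun c => dyadic_value (c * b))) => [x y|x y xy].
  by rewrite mulrDl dyadic_valueD.
by rewrite dyadic_value_mono; exact: semifield_leM2r.
Qed.

(** The preimage of [r] is the supremum in [S] of the dyadic truncations of
[r]. *)
Lemma dyadic_value_surj (r : R) : 0 <= r -> exists a, dyadic_value a = r.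
Proof.
move=> r0; pose t n := Num.truncn (r * 2 ^+ n).
have /= titv n := truncn_itv (mulr_ge0 r0 (ltW (pow2_gt0 n))).
pose s n : S := (t n)%:R * semifield_inv (2 ^+ n).
have sE n : s n * 2 ^+ n = (t n)%:R.
  by rewrite mulrAC semifield_mulrK //; exact: pow2_neq0.
have s_le n m : s n * 2 ^+ m <= (t m).+1%:R.
  rewrite -(semifield_le_pM2r _ _ (pow2_neq0 S n)) mulrAC sE -!natrX -!natrM.
  by apply: semifield_ler_nat; exact: truncn_pow2_lt.
have snd : nondecreasing_seq s.
  apply/nondecreasing_seqP => n.
  rewrite -(semifield_le_pM2r _ _ (pow2_neq0 S n.+1)) sE exprSr mulrA sE -natrM.
  by apply: semifield_ler_nat; exact: truncn_pow2_double.
have [|a [sub slub]] := complete snd.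
  by exists (t 0).+1%:R => _ [n _ <-]; have := s_le n 0; rewrite expr0 mulr1.
exists a.
have ta n : (t n)%:R <= dyadic_value a * 2 ^+ n.
  apply: dyadic_value_ge; rewrite -sE; apply: semifield_leM2r.
  by apply: sub; exists n.
have at_ n : dyadic_value a * 2 ^+ n <= (t n).+1%:R.
  apply: dyadic_value_le.
  rewrite -[leRHS](semifield_mulrK _ (pow2_neq0 S n)) mulrAC.
  apply: semifield_leM2r; apply: slub => _ [m _ <-].
  rewrite -(semifield_le_pM2r _ _ (pow2_neq0 S n)).
  apply: le_trans (s_le m n) _.
  by rewrite mulrAC semifield_mulrK //; exact: pow2_neq0.
apply: le_anti; apply/andP; split; apply: (@real_le_of_pow2 _ _ _ 1) => n.
  by apply: le_trans (at_ n) _; rewrite -natr1 lerD2r; case/andP: (titv n).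
have /andP[_ /ltW/le_trans->//] := titv n.
by rewrite -natr1 lerD2r; exact: ta.
Qed.

Lemma real_semifield_iso : posemifield_isomorphic S (real_semifield R).
Proof.
have nneg a : dyadic_value a \is Num.nneg := dyadic_value_ge0 a.
pose f a : real_semifield R := Sub (dyadic_value a) (nneg a).
have f0 : f 0 = 0 by apply: val_inj; rewrite rmorph0 /= dyadic_value0.
have fD : {morph f : a b / a + b}.
  by move=> a b; apply: val_inj; rewrite rmorphD /= dyadic_valueD.
have f1 : f 1 = 1 by apply: val_inj; rewrite rmorph1 /= dyadic_value1.
have fM : {morph f : a b / a * b}.
  by move=> a b; apply: val_inj; rewrite rmorphM /= dyadic_valueM.
pose F : {rmorphism S -> real_semifield R} := HB.pack f
  (GRing.isNmodMorphism.Build _ _ f (f0, fD))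
  (GRing.isMonoidMorphism.Build _ _ f (f1, fM)).
have Fmono : {mono F : a b / a <= b}.
  by move=> a b; rewrite real_semifield_leE /= dyadic_value_mono.
have surj (y : real_semifield R) : exists a, F a = y.
  have [a ay] := dyadic_value_surj (valP y : 0 <= val y).
  by exists a; apply: val_inj.
have [g gK] := choice surj.
exists F; split=> //; exists g => // a.
by apply: le_anti; rewrite -!Fmono gK lexx.
Qed.

End Value.

(** * The conditions hold for the reals and transfer along isomorphisms *)

Section Converse.

Lemma real_semifield_complete (R : realType) :
  monotone_sequentially_complete (real_semifield R).
Proof.
move=> a and_ [u aub].
pose A : set R := range (fun n => val (a n)).
have A0 : A !=set0 by exists (val (a 0)), 0%N.
have Aub : ubound A (val u).
  by move=> _ [n _ <-]; apply: (aub (a n)); exists n.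
have a_le n : val (a n) <= sup A.
  by apply: sup_upper_bound; [split; last exists (val u)|exists n].
have s0 : sup A \is Num.nneg.
  by apply: le_trans (a_le 0); exact: (valP (a 0)).
exists (Sub (sup A) s0); split=> [_ [n _ <-]|v vub]; first exact: a_le.
change (sup A <= val v); apply: ge_sup => // _ [n _ <-].
by apply: (vub (a n)); exists n.
Qed.

(** A lower bound [l] of the [1 + b n] is either at most [1], or [l - 1] is a
non-negative lower bound of the [b n]. *)
Lemma real_semifield_compat (R : realType) : infima_compatible (real_semifield R).
Proof.
move=> b m _ [mlb mglb]; split=> [_ [n _ <-]|l llb].
  by apply: semifield_leD => //; apply: mlb; exists n.
change (val l <= val (1 + m)); rewrite rmorphD rmorph1.
have [l1|/ltW l1] := leP (val l) 1.
  by rewrite (le_trans l1) // lerDl; exact: (valP m).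
have l1P : val l - 1 \is Num.nneg by rewrite nnegrE subr_ge0.
rewrite -lerBlDl; apply: (mglb (Sub (val l - 1) l1P)) => _ [n _ <-].
change (val l - 1 <= val (b n)); rewrite lerBlDl.
have : val l <= val (1 + b n) by apply: (llb (1 + b n)); exists n.
by rewrite rmorphD rmorph1.
Qed.

Lemma iso_complete (S T : poStrictSemifieldType) : posemifield_isomorphic S T ->
  monotone_sequentially_complete T -> monotone_sequentially_complete S.
Proof.
move=> [f [[g fK gK] fmono]] Tc a and_ [u aub].
have [||s [sub slub]] := Tc (f \o a).
- by move=> m n mn; rewrite /= fmono; exact: and_.
- by exists (f u) => _ [n _ <-]; rewrite /= fmono; apply: aub; exists n.
exists (g s); split=> [_ [n _ <-]|v vub].
  by rewrite -fmono gK; apply: sub; exists n.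
rewrite -fmono gK; apply: slub => _ [n _ <-].
by rewrite /= fmono; apply: vub; exists n.
Qed.

Lemma iso_compat (S T : poStrictSemifieldType) : posemifield_isomorphic S T ->
  infima_compatible T -> infima_compatible S.
Proof.
move=> [f [[g fK gK] fmono]] Tc b m bni [mlb mglb].
have [||_ glb] := Tc (f \o b) (f m).
- by move=> i j ij; rewrite /= fmono; exact: bni.
- split=> [_ [n _ <-]|l llb]; first by rewrite /= fmono; apply: mlb; exists n.
  rewrite -[l]gK fmono; apply: mglb => _ [n _ <-].
  by rewrite -fmono gK; apply: llb; exists n.
split=> [_ [n _ <-]|l llb].
  by apply: semifield_leD => //; apply: mlb; exists n.
rewrite -fmono rmorphD rmorph1; apply: glb => _ [n _ <-].
rewrite -(rmorph1 f) -rmorphD fmono.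
by apply: llb; exists n.
Qed.

End Converse.

Theorem proposition44 (R : realType) (S : poStrictSemifieldType) :
  posemifield_isomorphic S (real_semifield R) <->
  [/\ monotone_sequentially_complete S, infima_compatible S & (1 + 1 : S) <> 1].
Proof.
split=> [iso|[complete compat two_neq1]]; last exact: real_semifield_iso.
split.
- exact: iso_complete iso (@real_semifield_complete R).
- exact: iso_compat iso (@real_semifield_compat R).
have [f _] := iso => /(congr1 f); rewrite rmorphD rmorph1 => /(congr1 val).
rewrite rmorphD rmorph1 => /eqP.
by rewrite -subr_eq0 addrK (negPf (oner_neq0 _)).
Qed.
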